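(* Let $k\geq 1$ and $n\geq 3$ be integers. If $n\leq 2k+1$, then $\operatorname{depth}(S/I(C_n^k))=1$. If $n\geq 2k+2$, then $\operatorname{depth}(S/I(C_n^k))\geq\left\lceil\frac{n-k}{2k+1}\right\rceil$.
   Context: $K$ is a field and $S=K[x_1,\dots,x_n]$ is the polynomial ring. $C_n^k$ denotes the $k$-th power of the cycle on the vertex set $\{1,\dots,n\}$ ($n\ge 3$): for $1\le i<j\le n$, $\{i,j\}$ is an edge if and only if $j-i\le k$ or $j-i\ge n-k$ (so $C_n^k$ is the complete graph when $n\le 2k+1$). Its edge ideal $I(C_n^k)\subset S$ is the squarefree monomial ideal generated by all $x_ix_j$ with $\{i,j\}$ an edge of $C_n^k$. Depth is taken with respect to the graded maximal ideal $(x_1,\dots,x_n)$. *)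

(* Defs.v *)
From HB Require Import structures.
From mathcomp Require Import all_boot all_order all_algebra.
From mathcomp Require Import mpoly.
Set Implicit Arguments.
Unset Strict Implicit.
Unset Printing Implicit Defensive.
Import Order.TTheory GRing.Theory Num.Theory.
Local Open Scope ring_scope.

(* MathComp's [idealr] ideals are boolean predicates; here ideals are          *)
(* Prop-valued, so that generated ideals can be formed without a membership    *)
(* algorithm.                                                                  *)
Definition ideal_gen (R : comNzRingType) (G : R -> Prop) (f : R) : Prop :=
  exists s : seq (R * R),
    (forall p, p \in s -> G p.2) /\ f = \sum_(p <- s) p.1 * p.2.

Definition ideal_adjoin (R : comNzRingType) (I : R -> Prop) (fs : seq R) :
    R -> Prop :=
  ideal_gen (fun g => I g \/ g \in fs).

(* [fs] is a regular sequence on the R-module M = R/I.  As                     *)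
(* M/(f_1, .., f_i)M = R/(I + (f_1, .., f_i)), this is expressed by            *)
(* memberships in ideals of R; the last clause is M <> (fs)M.                  *)
Definition regular_seq (R : comNzRingType) (I : R -> Prop) (fs : seq R) :
    Prop :=
  (forall i, (i < size fs)%N -> forall g,
      ideal_adjoin I (take i fs) (fs`_i * g) -> ideal_adjoin I (take i fs) g)
  /\ ~ ideal_adjoin I fs 1.

(* [d] is the depth of R/I with respect to m: the maximal length of a regular  *)
(* sequence on R/I consisting of elements of m.                                *)
Definition is_depth (R : comNzRingType) (m I : R -> Prop) (d : nat) : Prop :=
  (exists fs, [/\ forall f, f \in fs -> m f, regular_seq I fs & size fs = d])
  /\ (forall fs, (forall f, f \in fs -> m f) -> regular_seq I fs ->
        (size fs <= d)%N).

Definition graded_maximal_ideal (K : fieldType) (n : nat) :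
    {mpoly K[n]} -> Prop :=
  ideal_gen (fun f : {mpoly K[n]} => exists i : 'I_n, f = 'X_i).

Definition edge_ideal (K : fieldType) (n : nat) (e : rel 'I_n) :
    {mpoly K[n]} -> Prop :=
  ideal_gen (fun f : {mpoly K[n]} => exists i j : 'I_n, e i j /\ f = 'X_i * 'X_j).

(* The vertices are 0, .., n-1 instead of 1, .., n.  The truncation in [n - k] *)
(* is harmless: when n < k, both 0 <= j - i and n - k <= j - i hold.           *)
Definition cycle_power (n k : nat) : rel 'I_n :=
  let adj (i j : 'I_n) := ((i < j) && ((j - i <= k) || (n - k <= j - i)))%N in
  [rel i j | adj i j || adj j i].

Definition cycle_power_ideal (K : fieldType) (n k : nat) :
    {mpoly K[n]} -> Prop :=
  edge_ideal (@cycle_power n k).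
Arguments graded_maximal_ideal : clear implicits.
Arguments cycle_power_ideal : clear implicits.

(* Main.v *)
(* Write e_i for the i-th elementary symmetric polynomial in all the variables.
   We show that e_1, .., e_t is a regular sequence on S/I whenever t is at most
   the stated bound.  From 0 -> S/(I : x_v) -> S/I -> S/(I, x_v) -> 0, a sequence
   regular on both ends is regular in the middle.  For an edge ideal the ends
   again come from graphs: deleting the neighbours of v, which makes v isolated,
   or deleting v.  Branching leads to edgeless graphs on vertex sets W with
   |W| >= t, where S/I is the polynomial ring K[x_W], and e_1, .., e_t is regular
   there over any field, even a finite one.  For C_n^k one branches on k
   consecutive vertices: deleting all of them leaves a path power on n - k
   vertices, while deleting the neighbours of one of them leaves it isolated next
   to a path power on n - 2k - 1 vertices.

   Conversely, a regular sequence f_1, .., f_r on S/I is algebraically independent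
   modulo I, so r is at most the growth exponent of the number of standard
   monomials of degree <= L: n in general, and 1 for the complete graph. *)
From Stdlib Require Import Classical.
Require Import Defs.
From mathcomp Require Import all_boot all_order all_algebra.
From mathcomp Require Import mpoly.
From mathcomp Require Import zify ring.
Import Order.TTheory GRing.Theory Num.Theory.
Local Open Scope ring_scope.
Set Implicit Arguments.
Unset Strict Implicit.
Unset Printing Implicit Defensive.

(** * Weakly regular sequences modulo an ideal *)

Section RegularSequences.
Variable R : comNzRingType.
Implicit Types (I J : R -> Prop) (f g h u : R) (fs : seq R).

Definition is_ideal I : Prop :=
  [/\ I 0, forall a b, I a -> I b -> I (a + b) & forall c a, I a -> I (c * a)].

Definition add_gen I f : R -> Prop := fun g => exists a c, I a /\ g = a + c * f.

Definition colon I u : R -> Prop := fun g => I (u * g).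

Definition same_ideal I J : Prop := forall g, I g <-> J g.

(** Only the nonzerodivisor clauses are kept: the unit ideal satisfies them too, so branches where
    the quotient vanishes are harmless. *)
Fixpoint wreg I fs : Prop :=
  if fs is f :: fs' then
    (forall g, I (f * g) -> I g) /\ wreg (add_gen I f) fs'
  else True.

Lemma ideal_sum I (T : eqType) (r : seq T) (F : T -> R) :
  is_ideal I -> (forall x, x \in r -> I (F x)) -> I (\sum_(x <- r) F x).
Proof.
by move=> [I0 ID _] h; rewrite big_seq; apply: big_ind.
Qed.

Lemma idealN I a : is_ideal I -> I a -> I (- a).
Proof. by case=> _ _ IM Ia; rewrite -mulN1r; apply: IM. Qed.

Lemma idealB I a b : is_ideal I -> I a -> I b -> I (a - b).
Proof.
by move=> idI Ia Ib; case: (idI) => _ ID _; apply: ID => //; apply: idealN.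
Qed.

Lemma is_ideal_add_gen I f : is_ideal I -> is_ideal (add_gen I f).
Proof.
case=> I0 ID IM; split.
- by exists 0, 0; split=> //; ring.
- move=> _ _ [a [c [Ia ->]]] [b [d [Ib ->]]].
  by exists (a + b), (c + d); split; [exact: ID | ring].
- move=> c _ [a [d [Ia ->]]].
  by exists (c * a), (c * d); split; [exact: IM | ring].
Qed.

Lemma sub_add_gen I f g : I g -> add_gen I f g.
Proof. by move=> Ig; exists g, 0; split=> //; ring. Qed.

Lemma mem_add_gen I f : is_ideal I -> add_gen I f f.
Proof. by case=> I0 _ _; exists 0, 1; split=> //; ring. Qed.

Lemma add_gen_min I J f :
  is_ideal J -> (forall g, I g -> J g) -> J f -> forall g, add_gen I f g -> J g.
Proof.
by case=> _ JD JM sIJ Jf _ [a [c [Ia ->]]]; apply: JD; [exact: sIJ | exact: JM].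
Qed.

Lemma same_idealC I J : same_ideal I J -> same_ideal J I.
Proof. by move=> e g; split=> /e. Qed.

Lemma same_add_gen I J f :
  same_ideal I J -> same_ideal (add_gen I f) (add_gen J f).
Proof. by move=> e g; split=> -[a [c [/e Ia ->]]]; exists a, c. Qed.

Lemma add_genAC I f g :
  same_ideal (add_gen (add_gen I f) g) (add_gen (add_gen I g) f).
Proof.
move=> h; split=> -[_ [c [[a [d [Ia ->]]] ->]]].
  by exists (a + c * g), d; split; [exists a, c | ring].
by exists (a + c * f), d; split; [exists a, c | ring].
Qed.

Lemma same_wreg I J fs : same_ideal I J -> wreg I fs -> wreg J fs.
Proof.
elim: fs I J => //= f fs IH I J e [regf regfs]; split.
  by move=> g /e /regf /e.
exact: IH (same_add_gen f e) regfs.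
Qed.

Lemma wreg_rcons I fs p : wreg I (rcons fs p) -> wreg I fs.
Proof. by elim: fs I => //= f fs IH I [? /IH]. Qed.

Lemma wreg_top I fs : is_ideal I -> I 1 -> wreg I fs.
Proof.
move=> idI I1; elim: fs I idI I1 => //= f fs IH I idI I1; split.
  by move=> g _; case: idI => _ _ IM; rewrite -[g]mulr1; apply: IM.
by apply: IH; [exact: is_ideal_add_gen | exact: sub_add_gen].
Qed.

(** Induction on [fs]. If f g is in I, then g = b + h u with b in I; cancelling f modulo I : u gives
    u h in I, hence g in I. To continue, colon and sum must commute with adding f to I. *)
Lemma wreg_colon_add I u fs :
  is_ideal I -> wreg (colon I u) fs -> wreg (add_gen I u) fs -> wreg I fs.
Proof.
elim: fs I => //= f fs IH I idI [regc regcs] [rega regas].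
have idA := is_ideal_add_gen u idI.
have [I0 ID IM] := idI.
split.
  move=> g Ifg; have [b [h [Ib eg]]] := rega g (sub_add_gen u Ifg).
  have Ifuh : I (u * (f * h)).
    have -> : u * (f * h) = f * g - f * b by rewrite eg; ring.
    by apply: idealB => //; apply: IM.
  have Iuh := regc h Ifuh.
  by rewrite eg [h * u]mulrC; apply: ID.
apply: IH; first exact: is_ideal_add_gen.
- apply: same_wreg regcs => h; split.
    by case=> a [c [Ia ->]]; exists (u * a), (u * c); split=> //; ring.
  (* If u h = b + c f, then f c is in I + (u), so c = b' + h2 u with b' in I, and h - h2 f lies in I
     : u. *)
  case=> b [c [Ib euh]].
  have Afc : add_gen I u (f * c).
    by exists (- b), h; split; [exact: idealN | rewrite [h * u]mulrC euh; ring].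
  have [b' [h2 [Ib' ec]]] := rega c Afc.
  exists (h - h2 * f), h2; split; last by ring.
  rewrite /colon; have -> : u * (h - h2 * f) = b + f * b'.
    by rewrite mulrBr euh ec; ring.
  by apply: ID => //; apply: IM.
- exact: same_wreg (add_genAC I u f) regas.
Qed.

Lemma is_ideal_gen (G : R -> Prop) : is_ideal (ideal_gen G).
Proof.
split.
- by exists [::]; split=> //; rewrite big_nil.
- move=> _ _ [s [sG ->]] [t [tG ->]]; exists (s ++ t); split; last first.
    by rewrite big_cat.
  by move=> p; rewrite mem_cat => /orP[/sG|/tG].
- move=> c _ [s [sG ->]]; exists [seq (c * p.1, p.2) | p <- s]; split.
    by move=> _ /mapP[p /sG Gp ->].
  by rewrite big_map mulr_sumr; apply: eq_bigr => p _; rewrite mulrA.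
Qed.

Lemma mem_ideal_gen (G : R -> Prop) g : G g -> ideal_gen G g.
Proof.
move=> Gg; exists [:: (1, g)]; split; last by rewrite big_seq1 mul1r.
by move=> p; rewrite inE => /eqP ->.
Qed.

Lemma ideal_gen_min (G J : R -> Prop) :
  is_ideal J -> (forall g, G g -> J g) -> forall g, ideal_gen G g -> J g.
Proof.
move=> idJ sGJ _ [s [sG ->]]; apply: ideal_sum => // p /sG /sGJ Jp.
by case: idJ => _ _; apply.
Qed.

Lemma ideal_adjoin_nil I : is_ideal I -> same_ideal (ideal_adjoin I [::]) I.
Proof.
move=> idI g; split; first by apply: ideal_gen_min => // h [].
by move=> Ig; apply: mem_ideal_gen; left.
Qed.

Lemma ideal_adjoin_cons I f fs : is_ideal I ->
  same_ideal (ideal_adjoin I (f :: fs)) (ideal_adjoin (add_gen I f) fs).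
Proof.
move=> idI g; split; apply: ideal_gen_min; try exact: is_ideal_gen.
  move=> h [Ih|]; first by apply: mem_ideal_gen; left; apply: sub_add_gen.
  rewrite inE => /predU1P[->|fsh]; apply: mem_ideal_gen; last by right.
  by left; apply: mem_add_gen.
move=> h [|fsh]; last first.
  by apply: mem_ideal_gen; right; rewrite inE fsh orbT.
apply: add_gen_min; first exact: is_ideal_gen.
- by move=> {}h Ih; apply: mem_ideal_gen; left.
- by apply: mem_ideal_gen; right; rewrite inE eqxx.
Qed.

Lemma wregP I fs : is_ideal I ->
  wreg I fs <->
  (forall i, (i < size fs)%N -> forall g,
      ideal_adjoin I (take i fs) (fs`_i * g) -> ideal_adjoin I (take i fs) g).
Proof.
elim: fs I => [|f fs IH] I idI; first by [].
have idA := is_ideal_add_gen f idI.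
split=> [[regf /(IH _ idA) regfs] [|i] /= lti g|reg].
- by move=> /(ideal_adjoin_nil idI)/regf/(ideal_adjoin_nil idI).
- by move/(ideal_adjoin_cons _ _ idI)/(regfs i lti)/(ideal_adjoin_cons _ _ idI).
split=> /=.
  move=> g Ifg; apply/(ideal_adjoin_nil idI).
  by apply: (reg 0%N) => //=; apply/(ideal_adjoin_nil idI).
apply/(IH _ idA) => i lti g.
move/(ideal_adjoin_cons _ _ idI)/(reg i.+1 lti).
by move/(ideal_adjoin_cons _ _ idI).
Qed.

End RegularSequences.

(** * Homogeneous ideals and lifting of regular sequences *)

Section Homogeneous.
Variables (K : fieldType) (n : nat).
Implicit Types (I : {mpoly K[n]} -> Prop) (f g p q : {mpoly K[n]}).

Local Notation pih := (pihomog mdeg).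

Definition homog_ideal I : Prop := forall d g, I g -> I (pih d g).

Lemma pihomogM d e p q : p \is e.-homog ->
  pih d (p * q) = if (e <= d)%N then p * pih (d - e) q else 0.
Proof.
move=> hp; have eq_q := pihomog_partitionE (leqnn (mmeasure mdeg q)).
set N := mmeasure mdeg q in eq_q; clearbody N.
rewrite {1}eq_q mulr_sumr raddf_sum /=.
have piM (j : nat) :
    pih d (p * pih j q) = if (e + j == d)%N then p * pih j q else 0.
  have hM := dhomogM hp (pihomogP mdeg j q).
  by case: eqP => [<-|/eqP ne]; [exact: pihomog_dE | exact: pihomog_ne0 hM].
under eq_bigr do rewrite piM.
rewrite -big_mkcond /=; case: leqP => [led|ltd]; last first.
  rewrite big_pred0 // => j; apply/negbTE.
  by rewrite neq_ltn (leq_trans ltd) ?leq_addr ?orbT.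
rewrite (eq_bigl (fun j : 'I_N => j == d - e :> nat)%N); last first.
  by move=> j; apply/eqP/eqP; lia.
case: (ltnP (d - e) N) => [lt|ge].
  by rewrite (big_pred1 (Ordinal lt)).
rewrite big_pred0; last first.
  by move=> j; apply/negbTE; rewrite neq_ltn (leq_trans _ ge).
rewrite eq_q raddf_sum big1 ?mulr0 //= => j _.
rewrite (pihomog_ne0 (d := j) _ (pihomogP mdeg j q)) //.
by rewrite neq_ltn (leq_trans (ltn_ord j) ge).
Qed.

Lemma homog_add_gen I f e :
  homog_ideal I -> f \is e.-homog -> homog_ideal (add_gen I f).
Proof.
move=> hI hf d _ [a [c [Ia ->]]].
exists (pih d a), (if (e <= d)%N then pih (d - e) c else 0).
split; first exact: hI.
rewrite raddfD /= [c * f]mulrC (pihomogM _ _ hf).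
by case: ifP; rewrite ?mul0r // mulrC.
Qed.

(* Graded Nakayama: the component of degree d of g is, modulo I, p times a
   component of lower degree of an element with the same property [P]. *)
Lemma homog_ideal_nakayama I p e g : is_ideal I -> homog_ideal I ->
  p \is e.-homog -> (0 < e)%N ->
  (exists P : {mpoly K[n]} -> Prop,
     P g /\ forall h, P h -> exists a h', [/\ I a, h = a + p * h' & P h']) ->
  I g.
Proof.
move=> idI hI hp e0 [P [Pg HP]].
suff H d : forall h, P h -> I (pih d h).
  rewrite (pihomog_partitionE (leqnn (mmeasure mdeg g))).
  by apply: ideal_sum => // j _; apply: H.
elim/ltn_ind: d => d IH h /HP[a [h' [Ia -> Ph']]].
case: (idI) => I0 ID IM.
rewrite raddfD /= (pihomogM _ _ hp); apply: ID; first exact: hI.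
by case: leqP => // led; apply: IM; apply: IH => //; lia.
Qed.

(* Regularity of f on R/I lifts from R/(I + p): if f h is in I then
   h = a + p h' with a in I and f h' in I, and one iterates. *)
Lemma wreg_lift I p e fs : is_ideal I -> homog_ideal I ->
  p \is e.-homog -> (0 < e)%N -> (forall g, I (p * g) -> I g) ->
  (forall f, f \in fs -> exists d, f \is d.-homog) ->
  wreg (add_gen I p) fs -> wreg I (rcons fs p).
Proof.
move=> idI hI hp e0; elim: fs I idI hI => [|f fs IH] I idI hI regp hfs //=.
move=> [regf regfs].
have [d hf] := hfs f (mem_head _ _).
have regfI g : I (f * g) -> I g.
  move=> Ifg; apply: (homog_ideal_nakayama idI hI hp e0).
  exists (fun h => I (f * h)); split=> // h Ifh.
  have [a [h' [Ia eh]]] := regf h (sub_add_gen p Ifh).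
  exists a, h'; split=> //; first by rewrite eh mulrC.
  apply: regp.
  have -> : p * (f * h') = f * h - f * a by rewrite eh; ring.
  by apply: idealB => //; case: idI => _ _; apply.
split=> //; apply: IH.
- exact: is_ideal_add_gen.
- exact: homog_add_gen hf.
(* [p] stays a nonzerodivisor modulo I + (f): if p g = a + h f, regularity of f modulo I + (p) gives
   h = b + h' p, and p cancels from p (g - h' f). *)
- move=> g [a [h [Ia epg]]].
  have [b [h' [Ib eh]]] : add_gen I p h.
    apply: regf; exists (- a), g; split; first exact: idealN.
    by rewrite [g * p]mulrC epg; ring.
  exists (g - h' * f), h'; split; last by ring.
  apply: regp.
  have -> : p * (g - h' * f) = a + f * b by rewrite mulrBr epg eh; ring.
  by case: idI => _ ID IM; apply: ID => //; apply: IM.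
- by move=> f' f'fs; apply: hfs; rewrite inE f'fs orbT.
- exact: same_wreg (add_genAC _ _ _) regfs.
Qed.

End Homogeneous.

(** * Bounding the length of a regular sequence by counting monomials *)

Section Bound.
Variables (K : fieldType) (n : nat).
Implicit Types (I : {mpoly K[n]} -> Prop) (fs : seq {mpoly K[n]}).

(* The monomial in [fs] whose exponents are the base-[N] digits of [x]. *)
Fixpoint digit_monomial (N : nat) fs (x : nat) : {mpoly K[n]} :=
  if fs is f :: fs' then f ^+ (x %% N) * digit_monomial N fs' (x %/ N)
  else 1.

(** Grouped by powers of f, the sum is that of the f^d G_d. Modulo I + (f) only G_0 survives, so its
    coefficients vanish by induction on [fs]; then f is cancelled and G_1 takes its place. *)
Lemma wreg_independent N I fs (c : nat -> K) : is_ideal I -> wreg I fs ->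
  ~ ideal_adjoin I fs 1 ->
  I (\sum_(0 <= x < N ^ size fs) c x *: digit_monomial N fs x) ->
  forall x, (x < N ^ size fs)%N -> c x = 0.
Proof.
elim: fs I c => [|f fs IH] I c idI /=.
  move=> _ I1; rewrite expn0 big_nat1 => Ic [|x] // _.
  apply/eqP/negPn/negP => c0; apply: I1; apply/(ideal_adjoin_nil idI).
  have -> : 1 = (c 0%N)^-1%:MP * (c 0%N *: 1) :> {mpoly K[n]}.
    by rewrite mul_mpolyC scalerA mulVf // scale1r.
  by case: idI => _ _; apply.
move=> [regf regfs] nI1.
have idA := is_ideal_add_gen f idI.
have {}nI1 : ~ ideal_adjoin (add_gen I f) fs 1.
  by move/(ideal_adjoin_cons _ _ idI).
case: (posnP N) => [->|N0]; first by rewrite exp0n.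
set M := (N ^ size fs)%N in IH *.
pose G d := \sum_(0 <= q < M) c (q * N + d)%N *: digit_monomial N fs q.
have -> : \sum_(0 <= x < N ^ (size fs).+1)
     c x *: (f ^+ (x %% N) * digit_monomial N fs (x %/ N))
   = \sum_(0 <= d < N) f ^+ d * G d.
  rewrite expnSr -/M big_nat_mul; under [RHS]eq_bigr do rewrite mulr_sumr.
  rewrite [RHS]exchange_big_nat /=; apply: eq_bigr => q _.
  rewrite -{1}[(q * N)%N]add0n mulSn big_addn addnK.
  apply: eq_big_nat => d /andP[_ ltd].
  rewrite [(d + _)%N]addnC modnMDl modn_small // divnMDl // divn_small // addn0.
  by rewrite scalerAr.
move=> IG.
have cG : forall d, (d < N)%N -> forall q, (q < M)%N -> c (q * N + d)%N = 0.
  (* [m] counts the powers still to be treated, once the G_d with d < N - m have vanished and f^(N -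
     m) has been cancelled. *)
  have step m : (m <= N)%N -> I (\sum_(0 <= d < m) f ^+ d * G (N - m + d)%N) ->
      forall d, (N - m <= d < N)%N ->
      forall q, (q < M)%N -> c (q * N + d)%N = 0.
    elim: m => [|m IHm] lem; first by move=> _ d; lia.
    rewrite big_nat_recl // expr0 mul1r addn0.
    under eq_bigr do rewrite exprS -mulrA.
    rewrite -mulr_sumr => Isum.
    have AG : add_gen I f (G (N - m.+1)%N).
      set S := \sum_(_ <= _ < _) _ in Isum.
      exists (G (N - m.+1)%N + f * S), (- S); split=> //; ring.
    have c0 := IH _ (fun q => c (q * N + (N - m.+1))%N) idA regfs nI1 AG.
    have G0 : G (N - m.+1)%N = 0.
      by rewrite /G big_nat big1 // => q /andP[_ ltq]; rewrite c0 ?scale0r.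
    move=> d /andP[led ltd] q ltq.
    have [-> //|ne] := eqVneq d (N - m.+1)%N; first exact: c0.
    apply: IHm => //; [exact: ltnW| |lia].
    rewrite G0 add0r in Isum; have := regf _ Isum.
    congr (I _); apply: eq_big_nat => i _; congr (_ * G _); lia.
  move=> d ltd; apply: (step N) => //; last by rewrite subnn.
  by rewrite subnn.
move=> x ltx; rewrite (divn_eq x N); apply: cG; first exact: ltn_pmod.
by rewrite ltn_divLR // -expnSr.
Qed.
Definition mdeg_le (L : nat) (f : {mpoly K[n]}) : Prop :=
  forall m, m \in msupp f -> (mdeg m <= L)%N.

Lemma mdeg_leM a b f g : mdeg_le a f -> mdeg_le b g -> mdeg_le (a + b) (f * g).
Proof.
move=> hf hg m /msuppM_le /allpairsP[[m1 m2] /= [/hf d1 /hg d2 ->]].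
by rewrite mdegD leq_add.
Qed.

Lemma mdeg_le1 a : mdeg_le a 1.
Proof. by move=> m; rewrite msupp1 inE => /eqP ->; rewrite mdeg0. Qed.

Lemma mdeg_leW a b f : (a <= b)%N -> mdeg_le a f -> mdeg_le b f.
Proof. by move=> ab h m /h; lia. Qed.

Lemma mdeg_leX a f i : mdeg_le a f -> mdeg_le (i * a) (f ^+ i).
Proof.
move=> hf; elim: i => [|i IH]; first exact: mdeg_le1.
by rewrite exprS mulSn; apply: mdeg_leM.
Qed.

Lemma mdeg_le_sum a (T : Type) (r : seq T) (F : T -> {mpoly K[n]}) :
  (forall x, mdeg_le a (F x)) -> mdeg_le a (\sum_(x <- r) F x).
Proof.
move=> hF; apply: big_ind => //; first by move=> m; rewrite msupp0.
move=> f g hf hg m /msuppD_le; rewrite mem_cat => /orP[/hf|/hg] //.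
Qed.

Lemma mdeg_le_digit_monomial D N fs x : (0 < N)%N ->
  (forall f, f \in fs -> mdeg_le D f) ->
  mdeg_le (size fs * (N * D)) (digit_monomial N fs x).
Proof.
move=> N0; elim: fs x => [|f fs IH] x hfs /=; first exact: mdeg_le1.
rewrite mulSn; apply: mdeg_leM; last first.
  by apply: IH => g gfs; apply: hfs; rewrite inE gfs orbT.
apply: mdeg_leW (mdeg_leX (i := x %% N) (hfs f (mem_head _ _))).
by rewrite leq_mul2r ltnW ?orbT // ltn_pmod.
Qed.

(** If r = [size fs] exceeded e, the N^r products with exponents below N would have bounded degree
    and be determined modulo I by fewer than N^r coefficients. A linear relation among these
    coefficient rows contradicts independence. *)
Lemma wreg_size_le I fs C e : is_ideal I ->
  (forall L, exists s : seq 'X_{1..n}, (size s <= C * L.+1 ^ e)%N /\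
     forall f, mdeg_le L f -> (forall m, m \in s -> f@_m = 0) -> I f) ->
  wreg I fs -> ~ ideal_adjoin I fs 1 -> (size fs <= e)%N.
Proof.
move=> idI hI regfs nI1; rewrite leqNgt; apply/negP => lter.
have [D hD] : exists D, forall f, f \in fs -> mdeg_le D f.
  exists (\max_(f <- fs) msize f)%N => f ffs m /msize_mdeg_lt ltm.
  exact: leq_trans (ltnW ltm) (leq_bigmax_seq _ ffs isT).
set r := size fs in lter *.
(* Chosen so that C (r N D + 1)^e <= C N^e (r D + 1)^e < N^(e+1) <= N^r. *)
pose N := (C * (r * D).+1 ^ e).+1.
have [s [les hs]] := hI (r * (N * D))%N.
have lts : (size s < N ^ r)%N.
  apply: (@leq_ltn_trans (C * (N * (r * D).+1) ^ e)).
    apply: leq_trans les _; rewrite leq_mul2l; apply/orP; right.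
    case: (posnP e) => [-> //|e0]; rewrite leq_exp2r // mulnS.
    by rewrite mulnCA -addn1 addnC leq_add2r.
  apply: (@leq_trans (N ^ e.+1)); last by rewrite leq_pexp2l.
  by rewrite expnMn mulnCA expnSr ltn_pmul2l ?expn_gt0.
pose A : 'M[K]_(N ^ r, size s) :=
  \matrix_(x, b) (digit_monomial N fs x)@_(nth 0%MM s b).
have : kermx A != 0.
  rewrite kermx_eq0 /row_free neq_ltn; apply/orP; left.
  exact: leq_ltn_trans (rank_leq_col A) lts.
case/rowV0Pn => v /sub_kermxP vA /negP; apply.
pose c x := if insub x is Some i then v 0 i else 0.
have cE (i : 'I_(N ^ r)) : c i = v 0 i by rewrite /c valK.
apply/eqP/rowP => i; rewrite mxE -cE.
apply: (wreg_independent idI regfs nI1) => //.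
apply: hs.
  apply: mdeg_le_sum => x m /msuppZ_le.
  by apply: mdeg_le_digit_monomial.
move=> m ms; rewrite big_mkord raddf_sum /=.
have ltb : (index m s < size s)%N by rewrite index_mem.
have := congr1 (fun B : 'rV_(size s) => B 0 (Ordinal ltb)) vA.
rewrite !mxE; apply: etrans; apply: eq_bigr => x _.
by rewrite !mxE mcoeffZ cE /= nth_index.
Qed.

End Bound.

(** * Stanley-Reisner ideals and elementary symmetric polynomials *)

Section SquarefreeIdeals.
Variables (K : fieldType) (n : nat).
Implicit Types (D : {set 'I_n} -> bool) (A B W U : {set 'I_n}).
Implicit Types (m : 'X_{1..n}) (f g : {mpoly K[n]}).

Definition mnm_support m : {set 'I_n} := [set i | m i != 0%N].

(* The Stanley-Reisner ideal of the simplicial complex [D]. *)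
Definition sr_ideal D f : Prop :=
  forall m, m \in msupp f -> ~~ D (mnm_support m).

Definition down_closed D : Prop := forall A B, A \subset B -> D B -> D A.

Lemma mnm_supportD m1 m2 :
  mnm_support (m1 + m2) = mnm_support m1 :|: mnm_support m2.
Proof. by apply/setP => i; rewrite !inE mnmDE; lia. Qed.

Lemma mnm_support_mesym1 A : mnm_support (mesym1 A) = A.
Proof. by apply/setP => i; rewrite inE mnmE; case: (i \in A). Qed.

Lemma same_sr_ideal D1 D2 : D1 =1 D2 -> same_ideal (sr_ideal D1) (sr_ideal D2).
Proof.
by move=> e f; split=> h m /h; [rewrite -e | rewrite e].
Qed.

Lemma sr_idealX D m : sr_ideal D 'X_[m] <-> ~~ D (mnm_support m).
Proof.
rewrite /sr_ideal msuppX; split; first by apply; rewrite inE.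
by move=> h m'; rewrite inE => /eqP ->.
Qed.

Lemma is_ideal_sr D : down_closed D -> is_ideal (sr_ideal D).
Proof.
move=> dcD; split.
- by move=> m; rewrite msupp0.
- move=> f g hf hg m /msuppD_le; rewrite mem_cat => /orP[/hf|/hg] //.
- move=> g f hf m /msuppM_le /allpairsP[[m1 m2] /= [_ /hf nD ->]].
  by apply: contra nD; apply: dcD; rewrite mnm_supportD subsetUr.
Qed.

Lemma ideal_monomials (I : {mpoly K[n]} -> Prop) f :
  is_ideal I -> (forall m, m \in msupp f -> I 'X_[m]) -> I f.
Proof.
move=> idI h; rewrite [f]mpolyE; apply: ideal_sum => // m /h Im.
by rewrite -mul_mpolyC; case: idI => _ _; apply.
Qed.

Lemma homog_ideal_sr D : down_closed D -> homog_ideal (sr_ideal D).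
Proof.
move=> /is_ideal_sr idD d f hf; rewrite pihomogE -big_filter.
apply: ideal_sum => // m; rewrite mem_filter => /andP[_ /hf nD].
by rewrite -mul_mpolyC; case: idD => _ _; apply; apply/sr_idealX.
Qed.

(** [mesym1 B] is the exponent vector of the product of the x_b for b in [B]; multiplying by it
    joins [B] to every support. The new complex is the star of [B]. *)
Lemma colon_sr D B :
  same_ideal (colon (sr_ideal D) 'X_[mesym1 B])
             (sr_ideal (fun A => D (B :|: A))).
Proof.
move=> f; rewrite /colon mulrC /sr_ideal; split=> h m mf.
  rewrite -{1}(mnm_support_mesym1 B) -mnm_supportD; apply: h.
  by rewrite (perm_mem (msuppMX _ _)); apply/mapP; exists m.
move: mf; rewrite (perm_mem (msuppMX _ _)) => /mapP[m' m'f ->].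
by rewrite mnm_supportD mnm_support_mesym1; apply: h.
Qed.

Lemma add_gen_sr D B : down_closed D ->
  same_ideal (add_gen (sr_ideal D) 'X_[mesym1 B])
             (sr_ideal (fun A => D A && ~~ (B \subset A))).
Proof.
move=> dcD.
have idD := is_ideal_sr dcD.
have idD' : is_ideal (sr_ideal (fun A => D A && ~~ (B \subset A))).
  apply: is_ideal_sr => A1 A2 s12 /andP[/(dcD _ _ s12) -> nB] /=.
  by apply: contra nB => /subset_trans; apply.
move=> f; split.
  apply: add_gen_min => //.
    by move=> g hg m /hg; rewrite negb_and => ->.
  by apply/sr_idealX; rewrite mnm_support_mesym1 subxx andbF.
move=> hf; apply: ideal_monomials; first exact: is_ideal_add_gen.
move=> m /hf; rewrite negb_and negbK => /orP[nD|sB].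
  by apply: sub_add_gen; apply/sr_idealX.
have le : (mesym1 B <= m)%MM.
  apply/mnm_lepP => i; rewrite mnmE; case: (boolP (i \in B)) => // /(subsetP sB).
  by rewrite inE lt0n.
rewrite -(submK le) mpolyXD.
by case: (is_ideal_add_gen 'X_[mesym1 B] idD) => _ _; apply; apply: mem_add_gen.
Qed.

(** Starts at e_1, since e_0 = 1 lies outside the maximal ideal. *)
Definition mesyms (t : nat) : seq {mpoly K[n]} :=
  [seq mesym n K i.+1 | i <- iota 0 t].

Lemma mesymsS t : mesyms t.+1 = rcons (mesyms t) (mesym n K t.+1).
Proof. by rewrite /mesyms -[in LHS]addn1 iotaD map_cat cats1. Qed.

Lemma mesym_homog k : mesym n K k \is k.-homog.
Proof.
apply/dhomogP => m; rewrite msupp_mesymP => /existsP[A /andP[/eqP <- /eqP ->]].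
exact: mdeg_mesym1.
Qed.

Lemma mesyms_homog t f : f \in mesyms t -> exists d, f \is d.-homog.
Proof. by case/mapP => i _ ->; exists i.+1; exact: mesym_homog. Qed.

Lemma down_closed_sub W : down_closed (fun A => A \subset W).
Proof. by move=> A B; apply: subset_trans. Qed.

Lemma same_add_gen_mod (I : {mpoly K[n]} -> Prop) p q :
  is_ideal I -> I (p - q) ->
  same_ideal (add_gen I p) (add_gen I q).
Proof.
move=> idI Ipq g; case: (idI) => _ ID IM.
split=> -[a [c [Ia ->]]].
  by exists (a + c * (p - q)), c; split; [apply: ID => //; exact: IM | ring].
by exists (a - c * (p - q)), c; split; [apply: idealB => //; exact: IM | ring].
Qed.

(** For B = W this is the boundary of the simplex; general [B] permits induction on its size. For b
    in [B], the colon by x_b replaces B by B - b, and adding x_b leaves the simplex on W - b. For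
    empty [B] the ideal is the whole ring. *)
Lemma wreg_boundary W B t : B \subset W ->
  (forall b, b \in W -> wreg (sr_ideal (fun A => A \subset W :\ b)) (mesyms t)) ->
  wreg (sr_ideal (fun A => (A \subset W) && ~~ (B \subset A))) (mesyms t).
Proof.
move=> sBW hW; have [k] := ubnP #|B|; elim: k B sBW => // k IH B sBW ltB.
have dcD A : down_closed (fun A' => (A' \subset W) && ~~ (A \subset A')).
  move=> A1 A2 s12 /andP[/(subset_trans s12) -> nB] /=.
  by apply: contra nB => /subset_trans; apply.
have idD := is_ideal_sr (dcD B).
have [B0|[b bB]] := set_0Vmem B.
  apply: wreg_top => //; rewrite -mpolyX0; apply/sr_idealX.
  by rewrite B0 sub0set andbF.
have bW := subsetP sBW b bB.
apply: (@wreg_colon_add _ _ 'X_[mesym1 [set b]]) => //.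
  apply: same_wreg (IH (B :\ b) _ _).
  - apply: same_idealC => f; rewrite (colon_sr _ _ f).
    apply: same_sr_ideal => A; rewrite subUset sub1set bW /=.
    by rewrite subDset.
  - by apply: subset_trans sBW; apply: subsetDl.
  - by move: ltB; rewrite (cardsD1 b) bB.
apply: same_wreg (hW b bW); apply: same_idealC => f.
rewrite (add_gen_sr _ (dcD B) f); apply: same_sr_ideal => A.
rewrite subsetD1 sub1set -andbA; congr (_ && _).
case: (boolP (b \in A)) => bA; rewrite ?andbF //= andbT.
by apply: contra bA => /subsetP; apply.
Qed.

(** Every other squarefree monomial of degree |W| involves a variable outside [W]. *)
Lemma mesym_eq_mod W :
  sr_ideal (fun A => A \subset W) (mesym n K #|W| - 'X_[mesym1 W]).
Proof.
rewrite mesymE (bigD1 W) //= addrAC subrr add0r.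
have idW := is_ideal_sr (@down_closed_sub W).
rewrite -big_filter; apply: ideal_sum => // B.
rewrite mem_filter => /andP[/andP[/eqP eqBW neBW] _]; apply/sr_idealX.
rewrite mnm_support_mesym1; apply: contra neBW => sBW.
by rewrite eqEcard sBW eqBW leqnn.
Qed.

(* If t < |W|, one lifts from K[x_(W - w)].  If t = |W|, then e_t is the product
   of the x_w for w in W modulo the ideal, and one lifts from the boundary of the
   simplex, whose facets W - b have t - 1 vertices. *)
Lemma wreg_simplex W t : (t <= #|W|)%N ->
  wreg (sr_ideal (fun A => A \subset W)) (mesyms t).
Proof.
have [k] := ubnP #|W|; elim: k W t => // k IH W t ltW leW.
have dcW := @down_closed_sub W; have idW := is_ideal_sr dcW.
have hW := homog_ideal_sr dcW.
have colonW B f : B \subset W ->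
    sr_ideal (fun A => A \subset W) ('X_[mesym1 B] * f) ->
    sr_ideal (fun A => A \subset W) f.
  move=> sBW /colon_sr; apply: (same_sr_ideal _ f).1 => A.
  by rewrite subUset sBW.
have [ltW'|geW] := ltnP t #|W|.
  have [w wW] : exists w, w \in W by apply/card_gt0P; apply: leq_ltn_trans ltW'.
  have cW : #|W :\ w| = #|W|.-1 by rewrite (cardsD1 w W) wW.
  (* Lifting appends the nonzerodivisor x_w, so the longer sequence is proved regular and then
     truncated. *)
  apply: (@wreg_rcons _ _ _ 'X_[mesym1 [set w]]).
  apply: (@wreg_lift _ _ _ _ 1) => //.
  - by rewrite dhomogX; apply/eqP; rewrite -(cards1 w); apply: mdeg_mesym1.
  - by move=> g; apply: colonW; rewrite sub1set.
  - exact: mesyms_homog.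
  apply: same_wreg (IH (W :\ w) t _ _); [|lia|lia].
  apply: same_idealC => f; rewrite (add_gen_sr _ dcW f).
  by apply: same_sr_ideal => A; rewrite subsetD1 sub1set.
have {leW geW} tE : t = #|W| by apply/eqP; rewrite eqn_leq leW.
case: t => [//|t] in tE *.
have eW := @mesym_eq_mod W; rewrite -tE in eW.
rewrite mesymsS; apply: (wreg_lift idW hW (mesym_homog t.+1)) => //.
- move=> g Ig; apply: (colonW W) => //.
  have -> : 'X_[mesym1 W] * g =
      mesym n K t.+1 * g - g * (mesym n K t.+1 - 'X_[mesym1 W]) by ring.
  by case: (idW) => _ _ IM; apply: idealB idW Ig (IM _ _ eW).
- exact: mesyms_homog.
have hbd : wreg (sr_ideal (fun A => (A \subset W) && ~~ (W \subset A))) (mesyms t).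
  apply: wreg_boundary => // b bW; have := cardsD1 b W; rewrite bW => cW.
  by apply: IH; lia.
apply: same_wreg hbd => f; rewrite -(add_gen_sr W dcW f).
apply: (same_add_gen_mod idW); rewrite -opprB; exact: idealN idW eW.
Qed.

End SquarefreeIdeals.

(** * Edge ideals and branching on a vertex *)

Section GraphIdeals.
Variables (K : fieldType) (n : nat) (e : rel 'I_n).
Hypotheses (e_sym : ssrbool.symmetric e) (e_irr : irreflexive e).
Implicit Types (A B F U : {set 'I_n}).

(** The independence complex of the graph induced on [U]. Vertices outside [U] lie in no face, so
    deleting vertices shrinks [U] while the polynomial ring stays fixed. *)
Definition independent_in U A : bool :=
  (A \subset U) && [forall i in A, forall j in A, ~~ e i j].

Lemma independentP U A :
  reflect (A \subset U /\ forall i j, i \in A -> j \in A -> ~~ e i j)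
          (independent_in U A).
Proof.
apply: (iffP andP) => -[sAU h]; split=> //.
  by move=> i j iA jA; move/forall_inP: h => /(_ i iA)/forall_inP/(_ j jA).
by apply/forall_inP => i iA; apply/forall_inP => j jA; apply: h.
Qed.

Lemma down_closed_independent U : down_closed (independent_in U).
Proof.
move=> A B sAB /independentP[sBU h]; apply/independentP.
split=> [|i j iA jA]; first exact: subset_trans sBU.
by apply: h; apply: (subsetP sAB).
Qed.

(* The isolated vertices in U stay in U as free variables. *)
Definition mesyms_regular t U : Prop :=
  wreg (sr_ideal (independent_in U)) (mesyms K n t).

Lemma mesyms_regular_edgeless t U : (t <= #|U|)%N ->
  (forall i j, i \in U -> j \in U -> ~~ e i j) -> mesyms_regular t U.
Proof.
move=> leU h; apply: same_wreg (wreg_simplex K leU); apply: same_sr_ideal => A.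
rewrite /independent_in; case: (boolP (A \subset U)) => //= /subsetP sAU.
by apply/esym/forall_inP => i iA; apply/forall_inP => j jA; apply: h; apply: sAU.
Qed.

(** The colon by x_v removes the neighbours of v and keeps v as an isolated vertex; adding x_v
    deletes v. *)
Lemma mesyms_regular_branch t U v : v \in U ->
  mesyms_regular t (U :\: [set i | e v i]) -> mesyms_regular t (U :\ v) ->
  mesyms_regular t U.
Proof.
rewrite /mesyms_regular => vU regN regD; have dcU := @down_closed_independent U.
apply: (@wreg_colon_add _ _ 'X_[mesym1 [set v]]); first exact: is_ideal_sr.
  apply: same_wreg regN; apply: same_idealC => f; rewrite (colon_sr _ _ f).
  apply: same_sr_ideal => A; apply/independentP/independentP => -[sA h].
    have [/subsetP sA1 {}sA] : [set v] \subset U /\ A \subset U.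
      by apply/andP; rewrite -subUset.
    split=> [|i j iA jA]; last by apply: h; rewrite inE ?iA ?jA orbT.
    apply/subsetP => i iA; rewrite !inE (subsetP sA) // andbT.
    by apply: h; rewrite !inE ?eqxx // iA orbT.
  have sAU i : i \in A -> ~~ e v i /\ i \in U.
    by move/(subsetP sA); rewrite !inE => /andP.
  split.
    by rewrite subUset sub1set vU; apply/subsetP => i /sAU[].
  move=> i j; rewrite !inE => /predU1P[->|iA] /predU1P[->|jA].
  - by rewrite e_irr.
  - by case: (sAU j jA).
  - by rewrite e_sym; case: (sAU i iA).
  - exact: h.
apply: same_wreg regD; apply: same_idealC => f; rewrite (add_gen_sr _ dcU f).
apply: same_sr_ideal => A; rewrite /independent_in subsetD1 sub1set.
by rewrite -!andbA [X in _ && X]andbC.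
Qed.

(** Branching at an endpoint i of an edge ij keeps i in one branch and j in the other, so the set
    shrinks without becoming empty. *)
Lemma mesyms_regular_nonempty U : (0 < #|U|)%N -> mesyms_regular 1 U.
Proof.
have [k] := ubnP #|U|; elim: k U => // k IH U ltU U0.
case: (boolP [exists i in U, exists j in U, e i j]); last first.
  rewrite negb_exists_in => /forall_inP h; apply: mesyms_regular_edgeless => //.
  by move=> i j /h + jU; rewrite negb_exists_in => /forall_inP; apply.
case/exists_inP => i iU /exists_inP[j jU eij].
have neij : j != i by apply: contraTneq eij => ->; rewrite e_irr.
apply: (mesyms_regular_branch iU); apply: IH.
- rewrite -ltnS; apply: leq_trans ltU; rewrite !ltnS.
  apply: proper_card; apply/properP.
  by split; [exact: subsetDl | exists j; rewrite // !inE eij].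
- by apply/card_gt0P; exists i; rewrite !inE e_irr.
- by move: ltU; rewrite (cardsD1 i U) iU.
- by apply/card_gt0P; exists j; rewrite !inE neij.
Qed.

Lemma edge_ideal_sr :
  same_ideal (edge_ideal (K := K) e) (sr_ideal (independent_in setT)).
Proof.
have idS := is_ideal_sr K (@down_closed_independent setT).
move=> f; split.
  apply: ideal_gen_min => // _ [i [j [eij ->]]].
  rewrite -mpolyXD; apply/sr_idealX; rewrite mnm_supportD.
  apply/negP => /independentP[_ /(_ i j)]; rewrite !inE !mnm1E !eqxx eij /= orbT.
  by case/(_ isT isT)/negP.
move=> hf; apply: ideal_monomials; first exact: is_ideal_gen.
move=> m /hf; rewrite /independent_in subsetT /= negb_forall_in.
case/exists_inP => i im; rewrite negb_forall_in => /exists_inP[j jm].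
rewrite negbK => eij.
(* Distinct endpoints make x_i x_j squarefree, so divisibility follows from the support alone. *)
have neij : i != j by apply: contraTneq eij => ->; rewrite e_irr.
have le : (U_(i) + U_(j) <= m)%MM.
  apply/mnm_lepP => l; rewrite mnmDE !mnm1E; move: im jm; rewrite !inE.
  have [<-|ni] := eqVneq i l; last by have [<-|//] := eqVneq j l; lia.
  by rewrite [j == i]eq_sym (negbTE neij); lia.
rewrite -(submK le) mpolyXD mpolyXD.
have [_ _ IM] := is_ideal_gen (fun f : {mpoly K[n]} =>
   exists i j : 'I_n, e i j /\ f = 'X_i * 'X_j).
by apply: IM; apply: mem_ideal_gen; exists i, j.
Qed.

End GraphIdeals.

(** The complex with only the empty face: membership means that the constant term vanishes. *)
Lemma graded_maximal_ideal_sr (K : fieldType) (n : nat) :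
  same_ideal (graded_maximal_ideal K n) (sr_ideal (fun A => A == set0)).
Proof.
have idS : is_ideal (@sr_ideal K n (fun A : {set 'I_n} => A == set0)).
  by apply: is_ideal_sr => A B sAB /eqP eB; rewrite -subset0 -eB.
move=> f; split.
  apply: ideal_gen_min => // _ [i ->]; apply/sr_idealX.
  by apply/set0Pn; exists i; rewrite inE mnm1E eqxx.
move=> hf; apply: ideal_monomials; first exact: is_ideal_gen.
move=> m /hf /set0Pn[i]; rewrite inE -lt0n => mi.
have le : (U_(i) <= m)%MM.
  by apply/mnm_lepP => l; rewrite mnm1E; have [<-|] := eqVneq i l.
rewrite -(submK le) mpolyXD.
have [_ _ IM] := is_ideal_gen (fun f : {mpoly K[n]} => exists i : 'I_n, f = 'X_i).
by apply: IM; apply: mem_ideal_gen; exists i.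
Qed.

(** * Powers of paths and cycles *)

Section CyclePower.
Variables (K : fieldType) (n k : nat).
Local Notation e := (@cycle_power n k).
Implicit Types (F : {set 'I_n}).

Lemma cycle_power_sym : ssrbool.symmetric e.
Proof. by move=> i j; rewrite /cycle_power /= orbC. Qed.

Lemma cycle_power_irr : irreflexive e.
Proof. by move=> i; rewrite /cycle_power /= ltnn. Qed.

(** When b - a + k <= n, no two members are joined around the cycle, so a path power is induced. *)
Definition itv (a b : nat) : {set 'I_n} := [set i : 'I_n | (a <= i < b)%N].

(* F holds the vertices isolated so far.  Branching on the neighbours of the end
   vertex a either deletes all k of them, which isolates a, or isolates one of
   them and removes at most 2k + 1 vertices from the path. *)
Lemma mesyms_regular_path t a b F : (b <= n)%N -> (b - a + k <= n)%N ->
  (forall i j, i \in F -> j \in F :|: itv a b -> ~~ e i j) ->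
  [disjoint F & itv a b] ->
  (t * (2 * k + 1) <= #|F| * (2 * k + 1) + (b - a) + 2 * k)%N ->
  mesyms_regular K e t (F :|: itv a b).
Proof.
have [l] := ubnP (b - a); elim: l a F => // l IH a F ltl leb len isoF disjF let_.
have [ba|ab] := leqP b a.
  have -> : itv a b = set0 by apply/setP => i; rewrite !inE; lia.
  (* The numerical hypothesis says t <= |F| + ceil((b - a) / (2k + 1)); on an empty path this is t
     <= |F|. *)
  rewrite setU0; apply: mesyms_regular_edgeless; first by nia.
  by move=> i j iF jF; apply: isoF; rewrite // inE jF.
have notF (i : 'I_n) : (a <= i < b)%N -> i \in F = false.
  move=> hi; apply: contraTF disjF => iF; apply/pred0Pn; exists i.
  by rewrite /= iF inE.
(* As v <= a + k, all path vertices before v are neighbours of v. Isolating v thus removes a, ..., v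
   + k, at most 2k + 1 vertices, and adds one to [F], which preserves the bound. *)
have branch (v : 'I_n) : (a <= v <= a + k)%N -> (v < b)%N ->
    mesyms_regular K e t ((v |: F) :|: itv (v + k + 1) b).
  move=> /andP[av vk] vb.
  have vF : v \notin F by rewrite notF // av.
  have vU : v \in F :|: itv a b by rewrite !inE av vb orbT.
  apply: IH => //; [lia|lia| | |].
  - move=> i j /setU1P[->|iF]; rewrite !inE.
      case/orP => [/predU1P[->|jF]|]; first by rewrite cycle_power_irr.
        by rewrite cycle_power_sym; apply: isoF.
      by rewrite /cycle_power /=; lia.
    case/orP => [/predU1P[->|jF]|hj]; apply: isoF => //; rewrite !inE ?jF //.
    by apply/orP; right; lia.
  - apply/pred0P => i /=; rewrite !inE -val_eqE /=.
    by case: (boolP (i \in F)) => [iF|_]; [move: (notF i); rewrite iF|]; lia.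
  - by rewrite cardsU1 vF; nia.
have an : (a < n)%N by apply: leq_trans leb.
pose va := Ordinal an.
(* The first k - j vertices after a are deleted. For j = 0 this isolates a; passing to j + 1
   branches on a + (k - j), the first vertex restored. *)
have step j : (j <= k)%N ->
    mesyms_regular K e t (F :|: (va |: itv (a + 1 + (k - j)) b)).
  elim: j => [_|j IHj ltjk].
    have := branch va; rewrite /= leqnn leq_addr => /(_ isT ab).
    congr mesyms_regular; apply/setP => i; rewrite !inE subn0 -val_eqE /=.
    by case: (i \in F) => /=; lia.
  have [bi|ib] := leqP b (a + (k - j)).
    move: (IHj (ltnW ltjk)); congr (mesyms_regular _ _ _ (_ :|: (_ |: _))).
    by apply/setP => i; rewrite !inE; lia.
  have vn : (a + (k - j) < n)%N by apply: leq_trans leb.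
  pose v := Ordinal vn.
  apply: (@mesyms_regular_branch _ _ _ cycle_power_sym cycle_power_irr _ _ v).
  - by rewrite !inE /=; lia.
  - have := branch v; rewrite /= => /(_ _ ib); move/(_ ltac:(lia)).
    congr mesyms_regular; apply/setP => i; rewrite !inE -!val_eqE /=.
    have := isoF i v; rewrite cycle_power_sym !inE /=; have := notF i.
    case: (i \in F) => /=; last by rewrite /cycle_power /=; lia.
    by move=> h /(_ isT) -> //; lia.
  - move: (IHj (ltnW ltjk)); congr mesyms_regular; apply/setP => i.
    rewrite !inE -!val_eqE /=; have := notF i.
    by case: (i \in F) => /=; lia.
have := step k (leqnn k); congr (mesyms_regular _ _ _ (_ :|: _)).
by apply/setP => i; rewrite !inE -val_eqE /=; lia.
Qed.

(** The vertices below k are branched on in increasing order. The path on n - k vertices gives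
    exactly the bound n + k; the other branches, with one isolated vertex and n - 2k - 1 path
    vertices, give n + 2k. *)
Lemma mesyms_regular_cycle_power t : (2 * k + 2 <= n)%N ->
  (t * (2 * k + 1) <= n + k)%N -> mesyms_regular K e t setT.
Proof.
move=> len let_.
have step j : (j <= k)%N -> mesyms_regular K e t (itv (k - j) n).
  elim: j => [_|j IHj ltjk].
    rewrite subn0 -[itv k n]set0U; apply: mesyms_regular_path => //; try lia.
    - by move=> i j; rewrite inE.
    - by apply/pred0P => i; rewrite /= !inE.
  have vn : (k - j.+1 < n)%N by lia.
  pose v := Ordinal vn.
  apply: (@mesyms_regular_branch _ _ _ cycle_power_sym cycle_power_irr _ _ v).
  - by rewrite !inE /=; lia.
  (* With all vertices below v deleted, the neighbours of v are the next k vertices and, around the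
     cycle, the last k - v. *)
  - have -> : itv (k - j.+1) n :\: [set i | e v i] =
        [set v] :|: itv (v + k + 1) (n - k + v).
      by apply/setP => i; have := ltn_ord i; rewrite !inE -val_eqE /cycle_power /=; lia.
    apply: mesyms_regular_path; rewrite /=; [lia|lia| | |].
    + move=> i j' /set1P ->; rewrite !inE => /predU1P[->|].
        by rewrite cycle_power_irr.
      by rewrite /cycle_power /=; lia.
    + by apply/pred0P => i /=; rewrite !inE -val_eqE /=; lia.
    + by rewrite cards1; lia.
  - move: (IHj (ltnW ltjk)); congr mesyms_regular; apply/setP => i.
    by rewrite !inE -!val_eqE /=; lia.
have := step k (leqnn k); congr mesyms_regular.
by apply/setP => i; rewrite !inE ltn_ord subnn.
Qed.

End CyclePower.

(** * Depth of the quotient by an edge ideal *)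

Section Depth.
Variables (K : fieldType) (n : nat) (e : rel 'I_n).
Hypotheses (e_sym : ssrbool.symmetric e) (e_irr : irreflexive e).
Local Notation I := (edge_ideal (K := K) e).
Local Notation m := (graded_maximal_ideal K n).

Lemma ideal_adjoin_nontrivial (fs : seq {mpoly K[n]}) :
  (forall f, f \in fs -> m f) -> ~ ideal_adjoin I fs 1.
Proof.
have idm : is_ideal m by exact: is_ideal_gen.
move=> hfs I1; have : m 1.
  apply: ideal_gen_min I1 => // g [Ig|/hfs //].
  apply: ideal_gen_min Ig => // _ [i [j [_ ->]]].
  by case: idm => _ _; apply; apply: mem_ideal_gen; exists j.
rewrite (graded_maximal_ideal_sr 1) -mpolyX0 => /sr_idealX/set0Pn[i].
by rewrite inE mnm0E.
Qed.

Lemma mesyms_maximal t f : f \in mesyms K n t -> m f.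
Proof.
case/mapP => i _ ->; apply/graded_maximal_ideal_sr => u.
rewrite msupp_mesymP => /existsP[A /andP[/eqP cA /eqP ->]].
by rewrite mnm_support_mesym1 -cards_eq0 cA.
Qed.

Lemma mesyms_regular_seq t :
  mesyms_regular K e t setT -> regular_seq I (mesyms K n t).
Proof.
move=> reg; split; last exact: ideal_adjoin_nontrivial (@mesyms_maximal t).
apply/wregP; first exact: is_ideal_gen.
exact: same_wreg (same_idealC (edge_ideal_sr e_irr)) reg.
Qed.

(** Monomials with independent support form a basis of S/I, so it suffices to count those of degree
    at most L. *)
Lemma size_regular_seq_le C d (fs : seq {mpoly K[n]}) :
  (forall L, exists2 s : seq 'X_{1..n}, (size s <= C * L.+1 ^ d)%N &
     forall u : 'X_{1..n}, independent_in e setT (mnm_support u) ->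
       (mdeg u <= L)%N -> u \in s) ->
  regular_seq I fs -> (size fs <= d)%N.
Proof.
move=> hC [regfs nI1]; have idI : is_ideal I by exact: is_ideal_gen.
apply: (wreg_size_le (C := C) idI) nI1; last exact/(wregP _ idI).
move=> L; have [s les hs] := hC L; exists s; split=> // f hf f0.
apply/(edge_ideal_sr e_irr f) => u uf; apply/negP => indu.
by have := uf; rewrite mcoeff_msupp f0 ?eqxx //; apply: hs => //; apply: hf.
Qed.

Lemma size_regular_seq_le_dim (fs : seq {mpoly K[n]}) :
  regular_seq I fs -> (size fs <= n)%N.
Proof.
apply: (size_regular_seq_le (C := 1)) => L.
exists [seq [multinom (h i : nat) | i < n] | h : {ffun 'I_n -> 'I_L.+1}].
  by rewrite size_map -cardT card_ffun !card_ord mul1n.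
move=> u _ leu; apply/mapP.
have ltu i : (u i < L.+1)%N.
  by rewrite ltnS (leq_trans _ leu) // mdegE (bigD1 i) //= leq_addr.
exists [ffun i => Ordinal (ltu i)]; first by rewrite mem_enum.
by apply/mnmP => i; rewrite mnmE ffunE.
Qed.

(** Independent sets have at most one vertex, so the standard monomials are pure powers, at most n
    (L + 1) of them up to degree L. *)
Lemma size_regular_seq_complete (fs : seq {mpoly K[n]}) : (0 < n)%N ->
  (forall i j, i != j -> e i j) -> regular_seq I fs -> (size fs <= 1)%N.
Proof.
move=> n0 ecomp; apply: (size_regular_seq_le (C := n)) => L.
exists [seq (U_(i) *+ d)%MM | i <- enum 'I_n, d <- iota 0 L.+1].
  by rewrite size_allpairs size_enum_ord size_iota expn1.
move=> u /independentP[_ indu] leu.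
have [i hi] : exists i : 'I_n, forall j, j != i -> u j = 0%N.
  have [u0|[i ui]] := set_0Vmem (mnm_support u).
    exists (Ordinal n0) => j _; apply/eqP; have := in_set0 j.
    by rewrite -u0 inE => /negbFE.
  exists i => j ne; apply/eqP/negPn/negP => uj.
  by have := indu j i; rewrite inE uj ui ecomp // => /(_ isT isT).
have eu : u = (U_(i) *+ u i)%MM.
  apply/mnmP => j; rewrite mulmnE mnm1E.
  by have [->|ne] := eqVneq j i; rewrite ?mul1n // hi.
apply/allpairsP; exists (i, u i); rewrite mem_enum mem_iota /=; split=> //.
by move: leu; rewrite eu mdegMn mdeg1 mul1n mulmnE mnm1E eqxx mul1n.
Qed.

(** Lengths of regular sequences are bounded by n, so replacing t by a larger attained length, as
    long as one exists, ends at the depth. *)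
Lemma depth_ge t : mesyms_regular K e t setT ->
  exists2 d, is_depth m I d & (t <= d)%N.
Proof.
move=> reg.
pose P d := exists fs,
  [/\ forall f, f \in fs -> m f, regular_seq I fs & size fs = d].
have bnd d : P d -> (d <= n)%N.
  by case=> fs [_ /size_regular_seq_le_dim + <-].
have Pt : P t.
  exists (mesyms K n t); split; first exact: mesyms_maximal.
    exact: mesyms_regular_seq.
  by rewrite size_map size_iota.
have [l] := ubnP (n - t); elim: l t {reg} Pt => // l IH t Pt ltl.
have [[d Pd ltd]|nP] := classic (exists2 d, P d & (t < d)%N).
  have [|d' Pd' led] := IH d Pd; first by have := bnd d Pd; lia.
  by exists d' => //; apply: leq_trans led; apply: ltnW.
exists t => //; split=> // fs hfs regfs; rewrite leqNgt; apply/negP => lt.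
by apply: nP; exists (size fs) => //; exists fs.
Qed.

End Depth.

Theorem theorem4p4 (K : fieldType) (n k : nat)
    (hk : (1 <= k)%N) (hn : (3 <= n)%N) :
  ((n <= 2 * k + 1)%N ->
     is_depth (graded_maximal_ideal K n) (cycle_power_ideal K n k) 1)
  /\
  ((2 * k + 2 <= n)%N ->
     exists d : nat,
       is_depth (graded_maximal_ideal K n) (cycle_power_ideal K n k) d
       /\ Num.ceil ((n%:R - k%:R) / (2 * k + 1)%N%:R : rat) <= d%:Z).
Proof.
have symC := @cycle_power_sym n k; have irrC := @cycle_power_irr n k.
split=> [len|len].
  split; last first.
    move=> fs _; apply: (size_regular_seq_complete irrC); first by lia.
    (* Since n - k <= k + 1, every difference is at most k or at least n - k: the graph is
       complete. *)
    move=> i j; rewrite -val_eqE /= /cycle_power /= => ne.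
    by have := ltn_ord i; have := ltn_ord j; lia.
  exists (mesyms K n 1); split=> //; first exact: mesyms_maximal.
  apply: (mesyms_regular_seq irrC); apply: (mesyms_regular_nonempty _ symC irrC).
  by rewrite cardsT card_ord; lia.
(* This floor equals ceil((n - k) / (2k + 1)), because n + k = (n - k) + 2k. *)
pose t := ((n + k) %/ (2 * k + 1))%N.
have ht : (t * (2 * k + 1) <= n + k)%N by apply: leq_divM.
have [d depthd led] := depth_ge irrC (mesyms_regular_cycle_power K len ht).
exists d; split=> //.
have h : (n <= d * (2 * k + 1) + k)%N.
  have := ltn_ceil (n + k) (isT : (0 < (2 * k).+1)%N).
  rewrite -addn1 -/t; nia.
rewrite real_ceil_le_int ?num_real // ler_pdivrMr ?ltr0n ?addn1 //.
by rewrite lerBlDr -addn1 pmulrn -natrM -natrD ler_nat.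
Qed.
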